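(* Let $F:[a,b]\times\mathbb R^d\to\mathbb R^d$, $u_0\in\mathbb R^d$, and let $U\in AC_g([a,b];\mathbb R^d)$ be an integral solution of $D_gU=F(t,U)$, $U(a)=u_0$. For every $t\in J_g$, $$U(t^+)=U(t)+\Delta g(t)\,F(t,U(t)).$$
   Context: Let $a<b$ be real, $d\in\mathbb N$, and let $g:[a,b]\to\mathbb R$ be nondecreasing and left-continuous. $\mu_g$ is the finite Lebesgue--Stieltjes measure on $[a,b)$ with $\mu_g([s,t))=g(t)-g(s)$ for $a\le s\le t\le b$. Standing assumption: $M_g:=\mu_g([a,b))=g(b)-g(a)>0$. $L_g^1([a,b))$ is the $L^1$ space for the completion of $\mu_g$; vector-valued spaces and integrals are componentwise. $J_g:=\{t\in[a,b):\Delta g(t):=g(t^+)-g(t)>0\}$ is the set of jump points, so $\mu_g(\{t\})=\Delta g(t)$ for $t\in J_g$. $AC_g([a,b];\mathbb R^d)$ is the set of functions $u:[a,b]\to\mathbb R^d$ such that, in each component, for every $\varepsilon>0$ there is $\delta>0$ such that, for every finite family of pairwise disjoint intervals $[a_j,b_j)\subset[a,b)$, $\sum_j(g(b_j)-g(a_j))<\delta$ implies $\sum_j|u(b_j)-u(a_j)|<\varepsilon$; equivalently (known), $u(t)=u(a)+\int_{[a,t)}v\,d\mu_g$ for all $t\in[a,b]$ with some $v\in L_g^1$, which is $\mu_g$-a.e. unique and denoted $D_gu$. $U\in AC_g([a,b];\mathbb R^d)$ is an integral solution of $D_gU=F(t,U)$, $U(a)=u_0$, if $F(\cdot,U(\cdot))\in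 L_g^1$ and $U(t)=u_0+\int_{[a,t)}F(s,U(s))\,d\mu_g(s)$ for all $t\in[a,b]$. *)

(* Defs.v *)
From HB Require Import structures.
From mathcomp Require Import all_boot all_order all_algebra.
From mathcomp Require Import all_classical all_reals all_analysis.
From mathcomp Require Import measurable_realfun.

Set Implicit Arguments.
Unset Strict Implicit.
Unset Printing Implicit Defensive.
Import Order.TTheory GRing.Theory Num.Theory.
Import numFieldNormedType.Exports.

Local Open Scope classical_set_scope.
Local Open Scope ring_scope.

(* Functions on [a, b] are represented by functions on the whole of R; their
   values outside [a, b] are irrelevant (right limits are only taken at points
   of [a, b[). *)

(* Left-continuity at a is void for a function on [a, b], hence `]a, b]. *)
Definition left_continuous_on (R : realType) (a b : R) (g : R -> R) : Prop :=
  forall t, t \in `]a, b] -> g x @[x --> t^'-] --> g t.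

(* A Borel measure on [a, b[ is a Borel measure on R concentrated on [a, b[. *)
Definition is_stieltjes (R : realType) (a b : R) (g : R -> R)
    (mu : {measure set (measurableTypeR R) -> \bar R}) : Prop :=
  (forall s t : R, a <= s -> s <= t -> t <= b ->
     mu `[s, t[%classic = (g t - g s)%:E) /\
  mu (~` `[a, b[%classic) = 0%E.

Section stieltjes_existence_uniqueness.
Variables (R : realType) (a b : R) (g : R -> R).
Hypothesis ab : a < b.

Let clamp (x : R) : R := Num.max a (Num.min x b).

(* g is left-continuous, whereas lebesgue_stieltjes_measure expects a
   right-continuous function: reflect through 0. *)
Let reflect (x : R) : R := - g (clamp (- x)).

Let clamp_in x : clamp x \in `[a, b].
Proof.
by rewrite /clamp in_itv/= le_max lexx/= ge_max (ltW ab)/= ge_min lexx orbT.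
Qed.

Let clamp_id x : x \in `[a, b] -> clamp x = x.
Proof.
by rewrite in_itv/= /clamp => /andP[ax xb]; rewrite (min_l xb) (max_r ax).
Qed.

Let clamp_homo : {homo clamp : x y / x <= y}.
Proof.
move=> x y xy; rewrite /clamp ge_max le_max lexx/= le_max; apply/orP; right.
by rewrite le_min !ge_min xy lexx orbT.
Qed.

Section existence.
Hypothesis ndg : {in `[a, b] &, {homo g : x y / x <= y}}.
Hypothesis lcg : left_continuous_on a b g.

Let reflect_nd : nondecreasing reflect.
Proof.
move=> x y xy; rewrite /reflect lerN2; apply: ndg => //.
by apply: clamp_homo; rewrite lerN2.
Qed.

Let clamp_lc x : g (clamp y) @[y --> x^'-] --> g (clamp x).
Proof.
have [xa|ax] := leP x a.
  have eqa y : y <= x -> clamp y = a.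
    by move=> yx; rewrite /clamp min_l ?max_l// ?(le_trans _ (ltW ab))//
      (le_trans yx).
  apply: cvg_near_cst; near=> y; rewrite !eqa//.
have [bx|xb] := ltP b x.
  have eqb y : b <= y -> clamp y = b.
    by move=> yb; rewrite /clamp (min_r yb) max_r// ltW.
  apply: cvg_near_cst; near=> y; rewrite !eqb ?(ltW bx)//.
  by near: y; exact: nbhs_left_ge.
have xab : x \in `]a, b] by rewrite in_itv/= ax.
rewrite clamp_id ?in_itv/= ?(ltW ax)//.
apply: cvg_trans (lcg xab); apply: near_eq_cvg; near=> y.
rewrite clamp_id// in_itv/=; apply/andP; split.
  by near: y; exact: nbhs_left_ge.
by rewrite (le_trans _ xb)//; near: y; exact: nbhs_left_le.
Unshelve. all: by end_near. Qed.

Let reflect_rc : right_continuous reflect.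
Proof.
move=> x; rewrite -(opprK x); apply/cvg_at_rightNP.
rewrite /reflect opprK; apply: cvgN.
have := @clamp_lc (- x).
by under [X in _ -> X]eq_cvg do rewrite /= opprK.
Qed.

Let reflect_cumulative := isCumulative.Build R _ R reflect reflect_nd reflect_rc.
HB.instance Definition _ := reflect_cumulative.

Lemma stieltjes_exists : exists mu, @is_stieltjes R a b g mu.
Proof.
have mN : measurable_fun setT (-%R : measurableTypeR R -> measurableTypeR R).
  exact: oppr_measurable.
have mab : measurable (`[a, b[%classic : set (measurableTypeR R)).
  exact: measurable_itv.
pose nu := measure_function_pushforward__canonical__measure_function_Measure
  (lebesgue_stieltjes_measure reflect) mN.
exists (mrestr nu mab); split => [s t as' st tb|]; last first.
  by rewrite /= /mrestr setICl measure0.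
rewrite /= /mrestr (_ : _ `&` _ = `[s, t[%classic); last first.
  apply/setIidPl => x /=; rewrite !in_itv/= => /andP[sx xt].
  by rewrite (le_trans as' sx) (lt_le_trans xt tb).
rewrite /pushforward opp_preimage_itvbndbnd/=.
rewrite /lebesgue_stieltjes_measure /measure_extension measurable_mu_extE/=; last first.
  exact: is_ocitv.
rewrite wlength_itv_bnd ?lerN2// /reflect !opprK !clamp_id.
- by rewrite addrC.
- by rewrite in_itv/= tb (le_trans as' st).
- by rewrite in_itv/= as' (le_trans st tb).
Qed.

End existence.

Lemma stieltjes_unique (mu nu : {measure set (measurableTypeR R) -> \bar R}) :
  is_stieltjes a b g mu -> is_stieltjes a b g nu ->
  forall A, measurable A -> mu A = nu A.
Proof.
have mI (x y : R) : measurable (`[x, y[%classic : set (measurableTypeR R)).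
  exact: measurable_itv.
have mR (x : R) : measurable (`[x, +oo[%classic : set (measurableTypeR R)).
  exact: measurable_itv.
have E (m : {measure set (measurableTypeR R) -> \bar R}) :
    is_stieltjes a b g m -> forall x, m `[x, +oo[%classic = (g b - g (clamp x))%:E.
  move=> [mst m0] x; have /[1!in_itv]/= /andP[ac cb] := clamp_in x.
  rewrite -mst// (_ : `[x, +oo[%classic =
      `[clamp x, b[%classic `|` (`[x, +oo[%classic `\` `[a, b[%classic)); last first.
    apply/seteqP; split => y /=; rewrite !in_itv/= ?andbT.
      move=> xy; have [yb|by'] := ltP y b; last by right; split => // /andP[].
      have [ay|ya] := leP a y; last by right; split => // /andP[].
      by left; rewrite /clamp ge_max ay ge_min xy.
    case=> [/andP[]|[]//]; rewrite /clamp ge_max ge_min => /andP[_].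
    by case/orP => // /le_lt_trans /[apply]; rewrite ltxx.
  rewrite measureU//; [|exact: measurableD|].
    rewrite [X in _ + X = _](_ : _ = 0)%E ?adde0//.
    apply: (subset_measure0 _ _ _ m0) => //.
    - exact: measurableD.
    - exact: measurableC.
  rewrite -subset0 => y [/=]; rewrite !in_itv/= => /andP[cy yb] [_]; apply.
  by rewrite yb (le_trans ac cy).
move=> Hmu Hnu A mA.
apply: (@measure_unique _ _ (measurableTypeR R) (@RGenCInfty.G R)
  (fun n => `[(- n%:R : R), +oo[%classic)) => //.
- exact: RGenCInfty.measurableE.
- move=> _ _ [x ->] [y ->]; exists (Num.max x y).
  by apply/seteqP; split => z /=; rewrite !in_itv/= !andbT ge_max => /andP.
- by move=> n; exists (- n%:R).
- rewrite -subTset => x _; exists (Num.bound `|x|) => //=.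
  rewrite in_itv/= andbT lerNl ltW// (le_lt_trans (ler_norm _))// normrN.
  exact: archi_boundP.
- by move=> _ [x ->]; rewrite !E.
- by move=> n; rewrite E// ltry.
Qed.

End stieltjes_existence_uniqueness.

(* By the two lemmas above it is determined on Borel sets as soon as g is
   nondecreasing and left-continuous on [a, b]; the zero measure is a default
   value that matters only for other g. *)
Definition stieltjes_measure (R : realType) (a b : R) (g : R -> R) :
    {measure set (measurableTypeR R) -> \bar R} :=
  match pselect (exists mu, @is_stieltjes R a b g mu) with
  | left ex => projT1 (cid ex)
  | right _ => mzero
  end.

Lemma stieltjes_measureP (R : realType) (a b : R) (g : R -> R) :
  a < b -> {in `[a, b] &, {homo g : x y / x <= y}} ->
  left_continuous_on a b g -> is_stieltjes a b g (stieltjes_measure a b g).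
Proof.
move=> ab ndg lcg; rewrite /stieltjes_measure; case: pselect => [ex|[]].
  by case: cid.
exact: stieltjes_exists.
Qed.

(* completed_measure_extension applied to a measure on a sigma-algebra restricts
   the induced outer measure to the Caratheodory sets; for a sigma-finite
   measure this is the completion. *)
Definition completed_stieltjes_measure (R : realType) (a b : R) (g : R -> R) :=
  @completed_measure_extension _ _ _ (stieltjes_measure a b g).
Arguments completed_stieltjes_measure {R} a b g.
HB.instance Definition _ (R : realType) (a b : R) (g : R -> R) :=
  Measure.on (completed_stieltjes_measure a b g).

Definition L1g (R : realType) (a b : R) (g : R -> R) (d : nat)
    (v : R -> 'rV[R]_d) : Prop :=
  forall i, (completed_stieltjes_measure a b g).-integrable `[a, b[%classic
              (fun s => (v s 0 i)%:E).

Definition integralg (R : realType) (a b : R) (g : R -> R) (d : nat)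
    (D : set R) (v : R -> 'rV[R]_d) : 'rV[R]_d :=
  \row_i \int[completed_stieltjes_measure a b g]_(s in D) (v s 0 i).

Definition ACg (R : realType) (a b : R) (g : R -> R) (d : nat)
    (u : R -> 'rV[R]_d) : Prop :=
  forall (i : 'I_d) (eps : R), 0 < eps -> exists2 delta : R, 0 < delta &
    forall (n : nat) (s t : 'I_n -> R),
      (forall j, [/\ a <= s j, s j < t j & t j <= b]) ->
      trivIset setT (fun j => `[s j, t j[%classic) ->
      \sum_(j < n) (g (t j) - g (s j)) < delta ->
      \sum_(j < n) `|u (t j) 0 i - u (s j) 0 i| < eps.

Definition integral_solution (R : realType) (a b : R) (g : R -> R) (d : nat)
    (F : R -> 'rV[R]_d -> 'rV[R]_d) (u0 : 'rV[R]_d) (U : R -> 'rV[R]_d) : Prop :=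
  [/\ ACg a b g U,
      L1g a b g (fun s => F s (U s)) &
      forall t, t \in `[a, b] ->
        U t = u0 + integralg a b g `[a, t[%classic (fun s => F s (U s))].

Definition jump (R : realType) (g : R -> R) (t : R) : R :=
  lim (g x @[x --> t^'+]) - g t.

Definition jump_points (R : realType) (a b : R) (g : R -> R) : set R :=
  [set t | a <= t < b /\ 0 < jump g t].

(* Main.v *)
(* For x > t the solution formula gives U x - U t as the integral of F(s, U s)
   over [t, x[. As x decreases to t these intervals shrink to {t}, so by
   dominated convergence the integral tends to mu_g{t} F(t, U t). The same
   argument applied to the constant 1 gives g x - g t -> mu_g{t}, that is,
   mu_g{t} = jump g t. *)
Require Import Defs.
From mathcomp Require Import all_boot all_order all_algebra.
From mathcomp Require Import all_classical all_reals all_analysis.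

Set Implicit Arguments.
Unset Strict Implicit.
Unset Printing Implicit Defensive.
Import Order.TTheory GRing.Theory Num.Theory.
Import numFieldNormedType.Exports.

Local Open Scope classical_set_scope.
Local Open Scope ring_scope.

(** Dominated convergence: the restrictions of [f] to the [D n] are bounded by [|f|], integrable on
    [A], and at each point of [A] they eventually equal the restriction of [f] to [E]. *)
Lemma cvg_Rintegral_set d (T : measurableType d) (R : realType)
    (mu : {measure set T -> \bar R}) (A E : set T) (D : (set T)^nat)
    (f : T -> R) :
  measurable A -> measurable E -> (forall n, measurable (D n)) ->
  mu.-integrable A (EFin \o f) ->
  (forall x, A x -> \forall n \near \oo, D n x <-> E x) ->
  \int[mu]_(x in A `&` D n) f x @[n --> \oo] --> \int[mu]_(x in A `&` E) f x.
Proof.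
move=> mA mE mD intf DE.
have intS B : measurable B -> mu.-integrable A ((EFin \o f) \_ B).
  move=> mB; apply/integrable_mkcond => //; rewrite -patch_setI setIC.
  rewrite -integrable_mkcond//; last exact: measurableI.
  by apply: integrableS intf => //; exact: measurableI.
rewrite /Rintegral; apply: fine_cvg; rewrite fineK; last first.
  apply: integrable_fin_num; first exact: measurableI.
  by apply: integrableS intf => //; exact: measurableI.
have := @dominated_convergence _ _ _ mu A mA
  (fun n => (EFin \o f) \_ (D n)) ((EFin \o f) \_ E) (abse \o (EFin \o f)).
case.
- by move=> n; exact: measurable_int (intS _ (mD n)).
- exact: measurable_int (intS _ mE).
- apply: aeW => x Ax; apply: cvg_near_cst.
  apply: filterS (DE x Ax) => n DnE; rewrite !patchE.
  rewrite (_ : (x \in D n) = (x \in E))//.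
  by apply/idP/idP; rewrite !inE => /DnE.
- exact: integrable_abse.
- apply: aeW => x Ax n; rewrite patchE.
  case: ifPn => _ /=; first exact: lexx.
  by rewrite normr0 lee_fin.
move=> _ _; rewrite -integral_mkcondr.
by under eq_fun do rewrite -integral_mkcondr.
Qed.

Lemma cvg_at_right_row (R : realType) d (u : R -> 'rV[R]_d) (t : R) (l : 'rV[R]_d) :
  (forall i, u x 0 i @[x --> t^'+] --> l 0 i) -> u x @[x --> t^'+] --> l.
Proof.
move=> ul; apply/cvg_mx_entourageP => B entB.
near=> x => i j; rewrite ord1 {i}; apply/mem_set; move: j.
(* There are finitely many columns, so the right neighbourhoods obtained for each of them intersect
   in one that serves all. *)
near: x; apply: filter_forall => j.
by have /cvg_entourageP/(_ _ entB) := ul j.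
Unshelve. all: by end_near. Qed.

Section completed_stieltjes.
Variables (R : realType) (a b : R) (g : R -> R).
Hypothesis ab : a < b.
Hypothesis ndg : {in `[a, b] &, {homo g : x y / x <= y}}.
Hypothesis lcg : left_continuous_on a b g.

Local Notation cT := (caratheodory_type (stieltjes_measure a b g)^*%mu).
Local Notation mu :=
  (completed_stieltjes_measure a b g : {measure set cT -> \bar R}).

Lemma completed_stieltjes_measurable_itv (I : interval R) :
  measurable ([set` I] : set cT).
Proof. by apply: caratheodory_measurable_mu_ext; exact: measurable_itv. Qed.
Let mitv := completed_stieltjes_measurable_itv.

(** On Borel sets the induced outer measure returns the original measure, so completing does not
    change the mass of a half-open interval. *)
Lemma completed_stieltjes_itv s t : a <= s -> s <= t -> t <= b ->
  mu `[s, t[%classic = (g t - g s)%:E.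
Proof.
move=> as_ st tb; have [<-// _] := stieltjes_measureP ab ndg lcg.
by rewrite /= /completed_stieltjes_measure /completed_measure_extension
  measurable_mu_extE.
Qed.

Lemma cvg_Rintegral_itv_right (f : R -> R) t : a <= t < b ->
  mu.-integrable `[a, b[%classic (fun s => (f s)%:E) ->
  \int[mu]_(s in `[t, x[) f s @[x --> t^'+] --> f t * fine (mu [set t]).
Proof.
move=> /andP[at_ tb] intf.
have sub x : x <= b -> `[a, b[%classic `&` `[t, x[%classic = `[t, x[%classic.
  move=> xb; apply/setIidPr => s /=; rewrite !in_itv/= => /andP[ts sx].
  by rewrite (le_trans at_ ts) (lt_le_trans sx xb).
have mt : measurable ([set t] : set cT).
  by rewrite -set_itv1; exact: mitv.
have <- : \int[mu]_(s in `[a, b[ `&` [set t]) f s = f t * fine (mu [set t]).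
  rewrite (_ : _ `&` _ = [set t]); last first.
    by apply/setIidPr => _ ->; rewrite /= in_itv/= at_.
  rewrite -Rintegral_cst//; apply: eq_Rintegral => s.
  by rewrite inE => ->.
(* Intersecting with [[a, b[] changes nothing once [x <= b], which holds near [t] since [t < b]; it
   provides a fixed domain on which [f] is integrable. *)
apply: (@cvg_trans _
    (\int[mu]_(s in `[a, b[ `&` `[t, x[) f s @[x --> t^'+])).
  apply: near_eq_cvg; near=> x; rewrite sub//.
  by near: x; exact: nbhs_right_le.
(* The right limit is tested along sequences [u n > t] tending to [t]. A point [s > t] leaves [[t, u
   n[] once [u n < s], a point [s < t] is never in it, and [t] always is. *)
apply/cvg_at_rightP => u [tu ut]; apply: cvg_Rintegral_set => // s _.
have [ts|st|<-] := ltgtP t s.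
- near=> n; split => [|->]; rewrite /= in_itv/= ?lexx ?tu//.
  move=> /andP[_ sun]; suff: u n < s by rewrite ltNge (ltW sun).
  by near: n; exact: (cvgr_lt _ ut).
- near=> n; split => [|->]; rewrite /= in_itv/= ?lexx ?tu//.
  by rewrite leNgt st.
- by near=> n; split => [//|_]; rewrite /= in_itv/= lexx tu.
Unshelve. all: by end_near. Qed.

Lemma completed_stieltjes_set1 t : a <= t < b -> fine (mu [set t]) = jump g t.
Proof.
move=> atb; have /andP[at_ tb] := atb; rewrite /jump.
(* The constant is integrable because [[a, b[] has the finite mass [g b - g a]. *)
have int1 : mu.-integrable `[a, b[%classic (fun s => (1 : R)%:E).
  apply/integrableP; split; first exact: measurable_cst.
  rewrite [ltLHS](_ : _ = \int[mu]_(s in `[a, b[) (1%:E))%E; last first.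
    by apply: eq_integral => s _; rewrite gee0_abs.
  by rewrite integral_cst//= mul1e completed_stieltjes_itv ?ltry// ltW.
have := cvg_Rintegral_itv_right atb int1; rewrite mul1r => mut.
(* [jump] is written with [lim], whose value is known only once convergence is proved; uniqueness of
   limits then identifies it. *)
suff /(cvg_lim (@Rhausdorff R)) -> : g x @[x --> t^'+] --> fine (mu [set t]) + g t.
  by rewrite addrK.
apply: cvg_trans (cvgD mut (cvg_cst (g t))); apply: near_eq_cvg; near=> x.
rewrite fctE/= Rintegral_cst// mul1r completed_stieltjes_itv ?subrK//=.
by near: x; exact: nbhs_right_le.
Unshelve. all: by end_near. Qed.

End completed_stieltjes.

Theorem proposition6p10 (R : realType) (a b : R) (d : nat) (g : R -> R)
  (F : R -> 'rV[R]_d -> 'rV[R]_d) (u0 : 'rV[R]_d) (U : R -> 'rV[R]_d)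
  (ab : a < b)
  (ndg : {in `[a, b] &, {homo g : x y / x <= y}})
  (lcg : left_continuous_on a b g)
  (Mg_gt0 : 0 < g b - g a)
  (solU : integral_solution a b g F u0 U) :
  forall t, t \in jump_points a b g ->
    U x @[x --> t^'+] --> U t + jump g t *: F t (U t).
Proof.
move=> t; rewrite inE => -[atb _]; have /andP[at_ tb] := atb.
have [_ intF UE] := solU; apply: cvg_at_right_row => i.
rewrite !mxE mulrC -(completed_stieltjes_set1 ab ndg lcg atb).
apply: cvg_trans (cvgD (cvg_cst (U t 0 i)) (cvg_Rintegral_itv_right atb (intF i))).
apply: near_eq_cvg; near=> x.
have tx : t <= x by near: x; exact: nbhs_right_ge.
have xb : x <= b by near: x; exact: nbhs_right_le.
(* Expanding both [U x] and [U t] and cancelling [u0] leaves the additivity of the integral over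
   [[a, t[] and [[t, x[]. *)
rewrite fctE/= (UE x) ?in_itv/= ?(le_trans at_ tx)// (UE t) ?in_itv/= ?at_ ?ltW//.
rewrite !mxE -addrA; congr (_ + _).
have mitv := @completed_stieltjes_measurable_itv R a b g.
have axE : `[a, t[%classic `|` `[t, x[%classic = `[a, x[%classic.
  by rewrite -itv_bndbnd_setU// bnd_simp.
rewrite -axE Rintegral_setU//; last first.
  apply/disj_setPS => s [] /=; rewrite !in_itv/= => /andP[_ st] /andP[].
  by rewrite leNgt st.
rewrite axE; apply: integrableS (intF i) => // s.
by rewrite /= !in_itv/= => /andP[-> /lt_le_trans ->].
Unshelve. all: by end_near. Qed.
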